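(* There exist a polynomial $f\in\mathbb{R}[x,y]$ of degree $2$ that is neither additive nor multiplicative and an absolute constant $c>0$ such that for every positive integer $n$ there are a finite set $A\subset\mathbb{R}$ with $|A|=n$ and a bipartite graph $G$ with both vertex classes equal to (copies of) $A$, i.e. with edge set $E(G)\subseteq A\times A$, satisfying \[ |E(G)|\ge c\,n^{3/2}\qquad\text{and}\qquad |f_G(A,A)|\le n, \] where $f_G(A,A)=\{f(a,b): (a,b)\in E(G)\}$.
   Context: A polynomial $f\in\mathbb{R}[x,y]$ is additive if there are polynomials $g,h,k\in\mathbb{R}[t]$ such that $f(x,y)=g(h(x)+k(y))$, and multiplicative if there are polynomials $g,h,k\in\mathbb{R}[t]$ such that $f(x,y)=g(h(x)\cdot k(y))$. For a bipartite graph $G$ on vertex classes $A,B$ with edge set $E(G)\subseteq A\times B$, the image of $f$ along $G$ is $f_G(A,B)=\{f(a,b):(a,b)\in E(G)\}$. *)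

(* Defs.v *)
From mathcomp Require Import all_boot all_order all_algebra finmap.
From mathcomp Require Import reals exp mpoly.

Set Implicit Arguments.
Unset Strict Implicit.
Unset Printing Implicit Defensive.

Import Order.TTheory GRing.Theory Num.Theory.

Local Open Scope fset_scope.
Local Open Scope ring_scope.

(* In [{mpoly R[2]}], ['X_ord0] is x and ['X_ord_max] is y;
   [horner_alg p g] is the composite polynomial g(p). *)
Definition additive_bipoly (R : realType) (f : {mpoly R[2]}) : Prop :=
  exists g h k : {poly R},
    f = horner_alg (horner_alg 'X_ord0 h + horner_alg 'X_ord_max k) g.

Definition multiplicative_bipoly (R : realType) (f : {mpoly R[2]}) : Prop :=
  exists g h k : {poly R},
    f = horner_alg (horner_alg 'X_ord0 h * horner_alg 'X_ord_max k) g.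

Definition eval2 (R : realType) (f : {mpoly R[2]}) (a b : R) : R :=
  f.@[tnth [tuple a; b]].

(* A bipartite graph on vertex classes A, B is given by its edge set
   E `<=` A `*` B, and the image of f along it depends on E only. *)
Definition graph_image (R : realType) (f : {mpoly R[2]})
    (E : {fset R * R}) : {fset R} :=
  [fset eval2 f e.1 e.2 | e in E].

(* Main.v *)
(** Take f = (x - y)^2 + x. On the diagonals y = x + d with d = O(sqrt n) it
    equals d^2 + x, so all of these diagonals inside {0, .., n-1}^2 give about
    n^(3/2) edges while f only takes values in {0, .., n-1}. If f were additive
    or multiplicative, its partial derivatives would factor through the
    derivative of the outer polynomial, which is impossible on the line
    y = x + 1/2, where f_x = 0 and f_y = 1. *)

Require Import Defs.
From mathcomp Require Import all_boot all_order all_algebra finmap.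
From mathcomp Require Import reals exp mpoly.
From mathcomp Require Import zify ring lra.

Set Implicit Arguments.
Unset Strict Implicit.
Unset Printing Implicit Defensive.

Import Order.TTheory GRing.Theory Num.Theory.

Local Open Scope fset_scope.
Local Open Scope ring_scope.

Lemma poly_ext (R : numDomainType) (p q : {poly R}) :
  (forall x, p.[x] = q.[x]) -> p = q.
Proof.
move=> pq; apply/eqP; rewrite -subr_eq0; apply/eqP.
apply: (@roots_geq_poly_eq0 _ _ [seq i%:R | i <- iota 0 (size (p - q))]).
- by apply/allP=> x _; rewrite rootE hornerD hornerN pq subrr.
- by rewrite map_inj_uniq ?iota_uniq //; apply: mulrIn; rewrite oner_eq0.
- by rewrite size_map size_iota.
Qed.

Lemma meval_horner_alg (R : comNzRingType) n (v : 'I_n -> R)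
    (p : {mpoly R[n]}) (g : {poly R}) :
  (horner_alg p g).@[v] = g.[p.@[v]].
Proof.
elim/poly_ind: g => [|g c IH]; first by rewrite rmorph0 meval0 horner0.
rewrite rmorphD rmorphM /= horner_algX horner_algC mevalD mevalM IH.
by rewrite mevalZ meval1 mulr1 hornerMXaddC.
Qed.

Definition shear (R : realType) : {mpoly R[2]} :=
  ('X_ord0 - 'X_ord_max) ^+ 2 + 'X_ord0.

Lemma eval2_shear (R : realType) (a b : R) :
  eval2 (shear R) a b = (a - b) ^+ 2 + a.
Proof. by rewrite /eval2 /shear mevalD rmorphXn /= mevalB !mevalXU. Qed.

(** The square of the linear form ['X_ord0 - 'X_ord_max] has total degree 2, and adding a term of
    degree 1 cannot cancel it. *)
Lemma msize_shear (R : realType) : msize (shear R) = 3%N.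
Proof.
have szX i : msize ('X_i : {mpoly R[2]}) = 2%N by rewrite msizeX mdeg1.
pose p : {mpoly R[2]} := 'X_ord0 - 'X_ord_max.
have szp : msize p = 2%N.
  apply/eqP; rewrite eqn_leq (leq_trans (msizeD_le _ _)) ?msizeN ?szX //=.
  rewrite ltnNge; apply/negP => /msize1_polyC pC.
  have ev a b : p.@[tnth [tuple a; b]] = a - b by rewrite mevalB !mevalXU.
  have := ev 0 0; rewrite pC mevalC subrr => p0.
  by have := ev 1 0; rewrite pC mevalC subr0 p0 => /eqP; rewrite eq_sym oner_eq0.
have p0 : p != 0 by rewrite -msize_poly_eq0 szp.
have szp2 : msize (p ^+ 2) = 3%N by rewrite expr2 msizeM // szp.
apply/eqP; rewrite eqn_leq (leq_trans (msizeD_le _ _)) ?szp2 ?szX //=.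
rewrite ltnNge; apply/negP => le2.
suff: (msize (p ^+ 2) <= 2)%N by rewrite szp2.
have -> : p ^+ 2 = shear R - 'X_ord0 by rewrite addrK.
by rewrite (leq_trans (msizeD_le _ _)) // msizeN szX geq_max (leq_trans le2) ?szp2.
Qed.

(* Differentiating both slices of f = (x - y)^2 + x on the line y = x + 1/2,
   where f_x = 0 and f_y = 1, shows that g' is nonzero there, so that
   alpha(y) h'(x) vanishes along the line and one of alpha, h' is zero. *)
Lemma shear_not_slicewise_affine (R : numFieldType)
    (g h k alpha beta alpha' beta' : {poly R}) :
  (forall a b, (a - b) ^+ 2 + a = g.[alpha.[b] * h.[a] + beta.[b]]) ->
  (forall a b,
    alpha.[b] * h.[a] + beta.[b] = alpha'.[a] * k.[b] + beta'.[a]) ->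
  False.
Proof.
move=> fE swap.
(* Chain rule for one slice: the pointwise identity is first upgraded to an equality of polynomials,
   which can be differentiated formally. *)
have slice (q u : {poly R}) c : (forall x, q.[x] = g.[u.[x]]) ->
    q^`().[c] = g^`().[u.[c]] * u^`().[c].
  move=> qE; have -> : q = g \Po u by apply: poly_ext => x; rewrite horner_comp.
  by rewrite deriv_comp hornerM horner_comp.
have dx (a b : R) : 2 * (a - b) + 1 =
    g^`().[alpha.[b] * h.[a] + beta.[b]] * (alpha.[b] * h^`().[a]).
  have := slice (('X - b%:P) ^+ 2 + 'X) (alpha.[b] *: h + beta.[b]%:P) a.
  rewrite !derivE !hornerE /= => <-; first by ring.
  by move=> x; rewrite !hornerE fE.
have dy (a b : R) : - 2 * (a - b) =
    g^`().[alpha.[b] * h.[a] + beta.[b]] * (alpha'.[a] * k^`().[b]).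
  have := slice ((a%:P - 'X) ^+ 2 + a%:P) (alpha'.[a] *: k + beta'.[a]%:P) b.
  rewrite !derivE !hornerE /= swap => <-; first by ring.
  by move=> x; rewrite !hornerE fE swap.
have : (alpha \Po ('X + 2^-1%:P)) * h^`() = 0.
  apply: poly_ext => a; rewrite hornerM horner_comp !hornerE.
  have /esym/eqP := dx a (a + 2^-1); have := dy a (a + 2^-1).
  have -> : - 2 * (a - (a + 2^-1)) = 1 :> R by field.
  have -> : 2 * (a - (a + 2^-1)) + 1 = 0 :> R by field.
  set G := g^`().[_] => G1; rewrite mulf_eq0 => /orP[/eqP G0|/eqP //].
  by move/eqP: G1; rewrite G0 mul0r oner_eq0.
(* At the origin f_x = 1, so neither factor of the vanishing product can be the zero polynomial. *)
have one_neq0 : alpha.[0] * h^`().[0] != 0.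
  apply/eqP => e0; have /eqP := dx 0 0.
  by rewrite e0 subrr !mulr0 add0r oner_eq0.
move=> /eqP; rewrite mulf_eq0 => /orP[/eqP a0|/eqP h0]; last first.
  by rewrite h0 horner0 mulr0 eqxx in one_neq0.
have := congr1 (horner^~ (- 2^-1)) a0.
rewrite /= horner_comp !hornerE addNr => e.
by rewrite e mul0r eqxx in one_neq0.
Qed.

(** The inner sum is affine in [h] with slope 1 and shift [k], and symmetrically affine in [k] with
    shift [h]. *)
Lemma shear_not_additive (R : realType) : ~ additive_bipoly (shear R).
Proof.
move=> [g [h [k fE]]].
apply: (@shear_not_slicewise_affine R g h k 1 k 1 h) => a b; last first.
  by rewrite !hornerE addrC.
rewrite -eval2_shear fE /eval2 meval_horner_alg mevalD !meval_horner_alg.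
by rewrite !mevalXU !hornerE.
Qed.

(** The inner product is affine in each of [h] and [k], with the other one as slope and shift 0. *)
Lemma shear_not_multiplicative (R : realType) :
  ~ multiplicative_bipoly (shear R).
Proof.
move=> [g [h [k fE]]].
apply: (@shear_not_slicewise_affine R g h k k 0 h 0) => a b; last first.
  by rewrite !hornerE mulrC.
rewrite -eval2_shear fE /eval2 meval_horner_alg mevalM !meval_horner_alg.
by rewrite !mevalXU !hornerE mulrC.
Qed.

Definition nat_grid (R : numDomainType) n : {fset R} :=
  [fset i%:R | i in iota 0 n].

Lemma card_nat_grid (R : numDomainType) n : #|` nat_grid R n| = n.
Proof.
rewrite card_imfset /=; last by apply: mulrIn; rewrite oner_eq0.
by rewrite undup_id ?iota_uniq ?size_iota.
Qed.

Lemma nat_gridP (R : numDomainType) n i : (i < n)%N -> i%:R \in nat_grid R n.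
Proof. by move=> lt_in; apply/imfsetP; exists i; rewrite //= mem_iota. Qed.

(** Each of the [d] diagonals is cut to the same [h] starting points, so that the edges are indexed
    by a full box. *)
Definition shear_graph (R : numDomainType) h d : {fset R * R} :=
  [fset ((val x.1)%:R, (val x.1 + val x.2)%:R) | x in {: 'I_h * 'I_d}].

Lemma card_shear_graph (R : numDomainType) h d :
  #|` shear_graph R h d| = (h * d)%N.
Proof.
rewrite card_imfset /= -?cardE ?card_prod ?card_ord // => -[i j] [i' j'] /= [].
move=> /eqP; rewrite eqr_nat => /eqP ii' /eqP.
by rewrite eqr_nat ii' eqn_add2l => /eqP/val_inj ->; rewrite (val_inj ii').
Qed.

(** The largest coordinate is (h - 1) + (d - 1), which must be at most n - 1. *)
Lemma shear_graph_sub (R : numDomainType) h d n : (h + d <= n.+1)%N ->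
  shear_graph R h d `<=` nat_grid R n `*` nat_grid R n.
Proof.
move=> hd; apply/fsubsetP => _ /imfsetP[[i j] _ ->] /=.
rewrite in_fsetM /=; have := ltn_ord i; have := ltn_ord j => ? ?.
by rewrite !nat_gridP //=; lia.
Qed.

(** The edge (i, i + j) has value j^2 + i, which is at most (d - 1)^2 + h - 1. *)
Lemma shear_image_sub (R : realType) h d n : (h + d.-1 ^ 2 <= n)%N ->
  graph_image (shear R) (shear_graph R h d) `<=` nat_grid R n.
Proof.
move=> hd; apply/fsubsetP => _ /imfsetP[_ /imfsetP[[i j] _ ->] ->] /=.
rewrite eval2_shear natrD opprD addrA subrr add0r sqrrN -natrX -natrD.
have := ltn_ord i; have := ltn_ord j => ? ?.
have : (j ^ 2 <= d.-1 ^ 2)%N by rewrite leq_sqr; lia.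
by move=> ?; apply: nat_gridP; lia.
Qed.

(** Here [d] is the square root of n/2 rounded up: the first bound provides enough diagonals, the
    second keeps the values of f below [n]. *)
Lemma sqrt_half_witness n : (0 < n)%N ->
  exists2 d, (n <= 2 * d ^ 2)%N & (2 * d.-1 ^ 2 < n)%N.
Proof.
move=> n0; have ex : exists d, (n <= 2 * d ^ 2)%N by exists n; nia.
case: (ex_minnP ex) => -[|d] le_n min_d; first by lia.
exists d.+1 => //=; rewrite ltnNge; apply/negP => /min_d; lia.
Qed.

Lemma powR_three_halves (R : realType) n :
  n%:R `^ (3 / 2) = n%:R * Num.sqrt n%:R :> R.
Proof.
have -> : 3 / 2 = 1 + 2^-1 :> R by field.
rewrite powRD; last by apply/implyP => /eqP; lra.
by rewrite powRr1 // powR12_sqrt.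
Qed.

Theorem theorem1p6 (R : realType) :
  exists (f : {mpoly R[2]}) (c : R),
    [/\ msize f = 3%N (* total degree 2 *),
        ~ additive_bipoly f,
        ~ multiplicative_bipoly f,
        0 < c
      & forall n : nat, (0 < n)%N ->
          exists (A : {fset R}) (E : {fset R * R}),
            [/\ #|` A| = n,
                E `<=` A `*` A,
                c * (n%:R `^ (3 / 2)) <= (#|` E|)%:R
              & (#|` graph_image f E| <= n)%N]].
Proof.
(* The constant collects two factors 1/2, from n <= 2 h and sqrt n <= 2 d, where h d is the number
   of edges. *)
exists (shear R), (4^-1); split.
- exact: msize_shear.
- exact: shear_not_additive.
- exact: shear_not_multiplicative.
- by rewrite invr_gt0 ltr0n.
move=> n n0; have [d le_nd lt_dn] := sqrt_half_witness n0.
exists (nat_grid R n), (shear_graph R (uphalf n) d); split.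
- exact: card_nat_grid.
(* Since d - 1 <= (d - 1)^2 < n/2, half of the grid is left for the starting points. *)
- by apply: shear_graph_sub; nia.
- rewrite card_shear_graph powR_three_halves natrM.
  have hn : n%:R <= 2 * (uphalf n)%:R :> R by rewrite -natrM ler_nat; lia.
  have sn : Num.sqrt n%:R <= 2 * d%:R :> R.
    rewrite -(ler_pXn2r (ltn0Sn 1)) ?nnegrE ?sqrtr_ge0 ?mulr_ge0 //.
    by rewrite sqr_sqrtr // -natrM -natrX ler_nat; nia.
  have := ler_pM (ler0n _ n) (sqrtr_ge0 n%:R) hn sn; lra.
- rewrite -[leqRHS](card_nat_grid R); apply: fsubset_leq_card.
  by apply: shear_image_sub; lia.
Qed.
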